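(* Let $G$ be a connected simple graph of $n$ vertices and let $F=\{f_i\}_{i\in[n]}$ be a $G(n,n-1)$-frame for $\mathbb{C}^{n-1}$. If $F$ is a tight frame, then $G$ must be a regular graph.
   Context: $[n]=\{1,\dots,n\}$. A sequence $\{f_i\}_{i\in[n]}$ in $\mathbb{C}^k$ is a frame for $\mathbb{C}^k$ if there are constants $A,B>0$ with $A\|f\|^2\le\sum_{i\in[n]}|\langle f,f_i\rangle|^2\le B\|f\|^2$ for all $f\in\mathbb{C}^k$; it is a tight frame if one can take $A=B$. Its Gramian matrix is the $n\times n$ matrix whose $(i,j)$ entry is $\langle f_j,f_i\rangle$ (inner product linear in the first argument). The Laplacian matrix of a simple graph $G$ with vertices $v_1,\dots,v_n$ is $L(G)=D(G)-A(G)$, where $D(G)$ is the diagonal matrix of vertex degrees and $A(G)$ is the adjacency matrix. A frame $\{f_i\}_{i\in[n]}$ for $\mathbb{C}^k$ is a $G(n,k)$-frame if its Gramian matrix equals $L(G)$. A graph is regular if all its vertices have the same degree. *)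

(* Defs.v *)
From mathcomp Require Import all_boot all_order all_algebra.
From mathcomp Require Import reals complex.

Set Implicit Arguments.
Unset Strict Implicit.
Unset Printing Implicit Defensive.
Import Order.TTheory GRing.Theory Num.Theory.

Local Open Scope ring_scope.
Local Open Scope complex_scope.

(* The complex numbers are R[i] for R : realType, and vectors of C^k are row
   vectors.  The inner product is [dotmx], i.e.
   dotmx u v = \sum_i u 0 i * (v 0 i)^*, linear in its first argument, so that
   ||f||^2 is [dotmx f f].  (The norm `|f| on matrices is the sup norm, hence
   not used.)  Order on R[i] is the partial order: x <= y iff x and y have the
   same imaginary part and Re x <= Re y. *)
Section Frames.
Variables (R : realType) (n k : nat).
Implicit Types (A B : R) (F : 'I_n -> 'rV[R[i]]_k).

Definition frame_bounds A B F : Prop :=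
  [/\ 0 < A, 0 < B &
      forall f : 'rV[R[i]]_k,
        A%:C * dotmx f f <= \sum_(i < n) `|dotmx f (F i)| ^+ 2
                         <= B%:C * dotmx f f].

Definition is_frame F : Prop := exists A B, frame_bounds A B F.

Definition is_tight_frame F : Prop := exists A, frame_bounds A A F.

Definition gramian F : 'M[R[i]]_n := \matrix_(i, j) dotmx (F j) (F i).

End Frames.

Section Graphs.
Variables (n : nat) (e : rel 'I_n).

Definition simple_graph : Prop := symmetric e /\ irreflexive e.

Definition connected_graph : Prop := forall i j, connect e i j.

Definition degree (i : 'I_n) : nat := #|[set j | e i j]|.

Definition regular_graph : Prop := forall i j, degree i = degree j.

Definition degree_mx (C : pzRingType) : 'M[C]_n :=
  diag_mx (\row_i (degree i)%:R).

Definition adjacency_mx (C : pzRingType) : 'M[C]_n :=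
  \matrix_(i, j) (e i j)%:R.

Definition laplacian_mx (C : pzRingType) : 'M[C]_n :=
  degree_mx C - adjacency_mx C.

End Graphs.

Definition is_graph_frame (R : realType) (n k : nat) (e : rel 'I_n)
    (F : 'I_n -> 'rV[R[i]]_k) : Prop :=
  is_frame F /\ gramian F = laplacian_mx e R[i].

(* Main.v *)
Require Import Defs.
From mathcomp Require Import all_boot all_order all_algebra.
From mathcomp Require Import reals complex.

(** The tight frame identity, applied to the frame vector [F j] itself, only
    involves inner products of frame vectors, that is, entries of the Gramian,
    here the Laplacian [L]: it reads [\sum_i `|L i j| ^+ 2 = A * L j j].
    Column [j] of [L] has the degree [d] of [j] on the diagonal and [d] entries
    [-1], so [d ^+ 2 + d = A * d] ([laplacian_col_sqr_norm]).  Hence every vertex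
    is isolated or has degree [A - 1] ([tight_frame_degree]).  An isolated vertex
    of a connected graph is its only vertex ([connected_isolated_unique]), so all
    degrees agree. *)

Import Order.TTheory GRing.Theory Num.Theory.
Local Open Scope ring_scope.
Local Open Scope complex_scope.

Lemma connected_isolated_unique (n : nat) (e : rel 'I_n) (i j : 'I_n) :
  connected_graph e -> degree e i = 0%N -> j = i.
Proof.
move=> hconn /eqP; rewrite /degree cards_eq0 => /eqP noedge.
have /connectP[[|x p] /= + ->] := hconn i j; first by [].
by case/andP=> eix _; have := in_set0 x; rewrite -noedge inE eix.
Qed.

Lemma laplacian_col_sqr_norm (C : numDomainType) (n : nat) (e : rel 'I_n)
    (j : 'I_n) : simple_graph e ->
  \sum_i `|laplacian_mx e C i j| ^+ 2
    = (degree e j)%:R ^+ 2 + (degree e j)%:R.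
Proof.
case=> esym eirr.
rewrite (bigD1 j) //= !mxE eqxx mulr1n eirr subr0 normr_nat; congr (_ + _).
have -> : (degree e j)%:R = \sum_i (e j i)%:R :> C.
  rewrite /degree -sum1_card natr_sum big_mkcond /=.
  by apply: eq_bigr => i _; rewrite inE; case: (e j i).
rewrite [RHS](bigD1 j) //= eirr add0r; apply: eq_bigr => i neq_ij.
rewrite !mxE (negPf neq_ij) mulr0n sub0r normrN normr_nat esym.
by case: (e j i); rewrite ?expr1n ?expr0n.
Qed.

Lemma laplacian_diag (C : pzRingType) (n : nat) (e : rel 'I_n) (j : 'I_n) :
  simple_graph e -> laplacian_mx e C j j = (degree e j)%:R.
Proof. by case=> _ eirr; rewrite !mxE eqxx mulr1n eirr subr0. Qed.

(** The diagonal part of [L *m L = A *: L]: a tight frame has a Gramian with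
    [A] as its only nonzero eigenvalue, and for a Laplacian the diagonal of this
    matrix identity already fixes every nonzero degree. *)
Lemma tight_frame_degree (R : realType) (n k : nat) (e : rel 'I_n)
    (F : 'I_n -> 'rV[R[i]]_k) (A : R) (j : 'I_n) :
  simple_graph e -> gramian F = laplacian_mx e R[i] ->
  frame_bounds A A F -> degree e j != 0%N ->
  (degree e j).+1%:R = A%:C.
Proof.
move=> he hgram [_ _ /(_ (F j)) /le_anti parseval] dj0.
have entry i : dotmx (F j) (F i) = laplacian_mx e R[i] i j.
  by rewrite -hgram mxE.
have dj0C : (degree e j)%:R != 0 :> R[i] by rewrite pnatr_eq0.
apply: (mulIf dj0C).
rewrite -(laplacian_diag _ _ _ _ he) -[in RHS]entry parseval.
under [RHS]eq_bigr do rewrite entry.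
by rewrite laplacian_col_sqr_norm // laplacian_diag // -natr1 mulrDl mul1r expr2.
Qed.

Theorem corollary4p2 (R : realType) (n : nat) (hn : (0 < n)%N) (e : rel 'I_n)
    (he : simple_graph e) (hconn : connected_graph e)
    (F : 'I_n -> 'rV[R[i]]_(n.-1)) (hF : is_graph_frame e F)
    (htight : is_tight_frame F) :
  regular_graph e.
Proof.
case: hF => _ hgram; case: htight => A hA i j.
have [di0|di0] := eqVneq (degree e i) 0%N.
  by rewrite (connected_isolated_unique _ _ _ j hconn di0).
have [dj0|dj0] := eqVneq (degree e j) 0%N.
  by rewrite (connected_isolated_unique _ _ _ i hconn dj0).
apply: succn_inj; apply: (@mulrIn R[i] 1 (oner_neq0 _)).
by rewrite !(tight_frame_degree _ _ _ _ _ _ _ he hgram hA).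
Qed.
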